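(* Let $(\mathfrak{g},[-,-],P)$ be a $Q$-admissible Rota-Baxter Lie algebra of weight $\lambda$ and let $r\in \mathfrak{g}\otimes \mathfrak{g}$ be an antisymmetric solution of the $Q$-admissible classical Yang-Baxter equation in $(\mathfrak{g},[-,-],P)$. Then $(\mathfrak{g},[-,-],P,\delta ,Q)$ is a coboundary Rota-Baxter Lie bialgebra, where the linear map $\delta=\delta_{r}:\mathfrak g\to\mathfrak g\otimes\mathfrak g$ is defined by $\delta_{r}(x)=(\mathrm{ad}(x)\otimes \mathrm{id}+\mathrm{id}\otimes\mathrm{ad}(x))r$ for all $x\in\mathfrak g$.
   Context: All vector spaces and algebras are finite-dimensional over a field $\mathbb K$ of characteristic zero; $\lambda\in\mathbb K$; $\tau$ is the flip; $\mathrm{ad}(x)y=[x,y]$. A Rota-Baxter Lie algebra of weight $\lambda$ is $(\mathfrak{g},[-,-],P)$ with $(\mathfrak g,[-,-])$ a Lie algebra and $P:\mathfrak g\to\mathfrak g$ linear with $[P(x),P(y)]=P([x,P(y)])+P([P(x),y])+\lambda P([x,y])$. It is $Q$-admissible, for a linear map $Q:\mathfrak g\to\mathfrak g$, if $Q([P(x),y])-[P(x),Q(y)]-Q([x,Q(y)])-\lambda[x,Q(y)]=0$ for all $x,y$. $r$ is antisymmetric if $r=-\tau(r)$. An element $r=\sum_i a_i\otimes b_i$ is a solution of the $Q$-admissible classical Yang-Baxter equation in $(\mathfrak{g},[-,-],P)$ if $[r_{12},r_{13}]+[r_{12},r_{23}]+[r_{13},r_{23}]=0$, $(P\otimes\mathrm{id}-\mathrm{id}\otimes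 Q)(r)=0$ and $(Q\otimes\mathrm{id}-\mathrm{id}\otimes P)(r)=0$, where $[r_{12},r_{13}]=\sum_{i,j}[a_{i},a_{j}]\otimes b_{i}\otimes b_{j}$, $[r_{12},r_{23}]=\sum_{i,j}a_{i}\otimes[b_{i},a_{j}]\otimes b_{j}$, $[r_{13},r_{23}]=\sum_{i,j}a_{i}\otimes a_{j}\otimes[b_{i},b_{j}]$. A Lie bialgebra $(\mathfrak{g},[-,-],\delta)$ is a Lie algebra with a Lie coalgebra structure $\delta$ (co-antisymmetric, co-Jacobi) such that $\delta([x,y])=(\mathrm{ad}(x)\otimes \mathrm{id}+\mathrm{id}\otimes\mathrm{ad}(x))\delta(y)-(\mathrm{ad}(y)\otimes \mathrm{id}+\mathrm{id}\otimes\mathrm{ad}(y))\delta(x)$. A Rota-Baxter Lie bialgebra of weight $\lambda$ is $(\mathfrak{g},[-,-],P,\delta,Q)$ such that $(\mathfrak{g},[-,-],\delta)$ is a Lie bialgebra, $(\mathfrak{g},[-,-],P)$ is a Rota-Baxter Lie algebra of weight $\lambda$ which is $Q$-admissible, and for all $x\in\mathfrak g$: $(Q\otimes Q)\delta(x)=(Q\otimes\mathrm{id}+\mathrm{id}\otimes Q)\delta(Q(x))+\lambda\delta(Q(x))$ and $(P\otimes Q)\delta(x)+(P\otimes\mathrm{id}-\mathrm{id}\otimes Q)\delta(P(x))+\lambda(P\otimes\mathrm{id})\delta(x)=0$. It is coboundary if $\delta=\delta_r$ for some $r\in\mathfrak g\otimes\mathfrak g$. *)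

(* Defs.v *)
From HB Require Import structures.
From mathcomp Require Import all_boot all_order all_algebra.

Set Implicit Arguments.
Unset Strict Implicit.
Unset Printing Implicit Defensive.

Import GRing.Theory.
Local Open Scope ring_scope.

(* Tensor products of finite-dimensional vector spaces.  The entry (i, j) of  *)
(* a tensor is its coordinate on e_i (x) e_j, where e is the basis            *)
(* vbasis fullv; tensor_liftE, tensor_eq and the bilinearity of tens are the  *)
(* universal property of the tensor product.                                  *)

Section Tensor.
Variable K : fieldType.

Definition tensor (U V : vectType K) : vectType K :=
  'M[K]_(\dim {:U}, \dim {:V}).

Definition tens (U V : vectType K) (u : U) (v : V) : tensor U V :=
  \matrix_(i, j) (coord (vbasis {:U}) i u * coord (vbasis {:V}) j v).

(* The linear map on U (x) V sending u (x) v to b u v, for b bilinear. *)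
Definition tensor_lift (U V W : vectType K) (b : U -> V -> W)
    (t : tensor U V) : W :=
  \sum_(i < \dim {:U}) \sum_(j < \dim {:V})
    (t : 'M_(_, _)) i j *: b (vbasis {:U})`_i (vbasis {:V})`_j.

Fact tens_is_bilinear (U V : vectType K) :
  bilinear_for *:%R *:%R (@tens U V).
Proof.
split=> [v a u u' | u a v v']; apply/matrixP=> i j; rewrite !mxE linearP.
  by rewrite mulrDl mulrA.
by rewrite mulrDr mulrCA.
Qed.

HB.instance Definition _ (U V : vectType K) :=
  bilinear_isBilinear.Build K U V (tensor U V) *:%R *:%R (@tens U V)
    (tens_is_bilinear U V).

Fact tensor_lift_is_linear (U V W : vectType K) (b : U -> V -> W) :
  linear (tensor_lift b).
Proof.
move=> a t t'; rewrite /tensor_lift scaler_sumr -big_split /=.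
apply: eq_bigr => i _; rewrite scaler_sumr -big_split /=.
by apply: eq_bigr => j _; rewrite !mxE scalerDl scalerA.
Qed.

HB.instance Definition _ (U V W : vectType K) (b : U -> V -> W) :=
  GRing.isLinear.Build K (tensor U V) W _ (tensor_lift b)
    (tensor_lift_is_linear b).

Lemma tensor_liftE (U V W : vectType K) (b : U -> V -> W) :
    bilinear_for *:%R *:%R b ->
  forall u v, tensor_lift b (tens u v) = b u v.
Proof.
move=> b2 u v.
pose m := bilinear_isBilinear.Build K U V W *:%R *:%R b b2.
pose b' : {bilinear U -> V -> W} := HB.pack b m.
rewrite -[b]/(b' : U -> V -> W); move: b' => {}b {m b2}.
rewrite {2}(coord_vbasis (memvf u)) linear_sumlz; apply: eq_bigr => i _.
rewrite {2}(coord_vbasis (memvf v)) linear_sumr; apply: eq_bigr => j _ /=.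
by rewrite linearZl_LR linearZr_LR /= scalerA !mxE.
Qed.

Lemma tensor_std (U V : vectType K) (t : tensor U V) :
  t = \sum_(i < \dim {:U}) \sum_(j < \dim {:V})
        (t : 'M_(_, _)) i j *: tens (vbasis {:U})`_i (vbasis {:V})`_j.
Proof.
rewrite [LHS]matrix_sum_delta; apply: eq_bigr => i _; apply: eq_bigr => j _.
congr (_ *: _); apply/matrixP=> k l; rewrite !mxE.
rewrite !coord_free ?(basis_free (vbasisP _)) //.
by rewrite -natrM mulnb eq_sym [l == j]eq_sym.
Qed.

Lemma tensor_eq (U V W : vectType K) (f f' : {linear tensor U V -> W}) :
  (forall u v, f (tens u v) = f' (tens u v)) -> f =1 f'.
Proof.
move=> eq_ff' t; rewrite (tensor_std t) !linear_sum; apply: eq_bigr => i _.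
rewrite !linear_sum; apply: eq_bigr => j _.
by rewrite !linearZ /= eq_ff'.
Qed.

Lemma tensor_lift_linear_fun (U V W : vectType K) (a : K)
    (b1 b2 b3 : U -> V -> W) (t : tensor U V) :
    (forall u v, b3 u v = a *: b1 u v + b2 u v) ->
  tensor_lift b3 t = a *: tensor_lift b1 t + tensor_lift b2 t.
Proof.
move=> b3E; rewrite /tensor_lift scaler_sumr -big_split /=.
apply: eq_bigr => i _; rewrite scaler_sumr -big_split /=.
by apply: eq_bigr => j _; rewrite b3E scalerDr !scalerA [a * _]mulrC.
Qed.

Definition tensor_map (U V U' V' : vectType K) (f : U -> U') (h : V -> V') :
    tensor U V -> tensor U' V' :=
  tensor_lift (fun u v => tens (f u) (h v)).

HB.instance Definition _ (U V U' V' : vectType K) (f : U -> U')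
    (h : V -> V') := GRing.Linear.on (tensor_map f h).

Definition tensor_flip (U V : vectType K) : tensor U V -> tensor V U :=
  tensor_lift (fun u v => tens v u).

HB.instance Definition _ (U V : vectType K) :=
  GRing.Linear.on (@tensor_flip U V).

Definition tensor_cycle (U V W : vectType K) :
    tensor U (tensor V W) -> tensor W (tensor U V) :=
  tensor_lift (fun u => tensor_lift (fun v w => tens w (tens u v))).

HB.instance Definition _ (U V W : vectType K) :=
  GRing.Linear.on (@tensor_cycle U V W).

Lemma tensor_mapE (U V U' V' : vectType K) (f : {linear U -> U'})
    (h : {linear V -> V'}) (u : U) (v : V) :
  tensor_map f h (tens u v) = tens (f u) (h v).
Proof.
apply: (tensor_liftE (b := fun u v => tens (f u) (h v))).
by split=> z a x y; rewrite linearP ?linearPl ?linearPr.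
Qed.

Lemma tensor_flipE (U V : vectType K) (u : U) (v : V) :
  tensor_flip (tens u v) = tens v u.
Proof.
apply: (tensor_liftE (b := fun u v => tens v u)).
by split=> z a x y; rewrite ?linearPl ?linearPr.
Qed.

Lemma tensor_cycleE (U V W : vectType K) (u : U) (v : V) (w : W) :
  tensor_cycle (tens u (tens v w)) = tens w (tens u v).
Proof.
have b2 u' : bilinear_for *:%R *:%R (fun v w => tens w (tens u' v)).
  by split=> z a x y; do 2 rewrite ?(linearPl, linearPr) /=.
rewrite [LHS]tensor_liftE ?tensor_liftE //; split=> z a x y; last exact: linearP.
apply: tensor_lift_linear_fun => v' w' /=.
by do 2 rewrite ?(linearPl, linearPr) /=.
Qed.

End Tensor.

Notation "u \ox v" := (tens u v)
  (at level 40, left associativity) : ring_scope.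

Section LieBialgebra.
Variables (K : fieldType) (g : vectType K).
Implicit Types (lam : K) (br : {bilinear g -> g -> g}) (P Q : {linear g -> g}).
Implicit Types (delta : {linear g -> tensor g g}) (r s : tensor g g).

Record lie_algebra br : Prop := LieAlgebra {
  lie_alternating : forall x, br x x = 0;
  lie_jacobi : forall x y z,
    br x (br y z) + br y (br z x) + br z (br x y) = 0
}.

Record rota_baxter_lie_algebra lam br P : Prop := RotaBaxterLieAlgebra {
  rbla_lie : lie_algebra br;
  rbla_rota_baxter : forall x y,
    br (P x) (P y) = P (br x (P y)) + P (br (P x) y) + lam *: P (br x y)
}.

Definition rb_admissible lam br P Q : Prop :=
  forall x y,
    Q (br (P x) y) - br (P x) (Q y) - Q (br x (Q y)) - lam *: br x (Q y) = 0.

(* (ad(x) (x) id + id (x) ad(x)) t *)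
Definition ad_tensor br (x : g) (t : tensor g g) : tensor g g :=
  tensor_map (br x) idfun t + tensor_map idfun (br x) t.

Record lie_coalgebra delta : Prop := LieCoalgebra {
  lieco_antisym : forall x, delta x = - tensor_flip (delta x);
  lieco_jacobi : forall x,
    let t := tensor_map idfun delta (delta x) in
    t + tensor_cycle t + tensor_cycle (tensor_cycle t) = 0
}.

Record lie_bialgebra br delta : Prop := LieBialgebra {
  liebi_lie : lie_algebra br;
  liebi_lieco : lie_coalgebra delta;
  liebi_cocycle : forall x y,
    delta (br x y) = ad_tensor br x (delta y) - ad_tensor br y (delta x)
}.

Record rota_baxter_lie_bialgebra lam br P delta Q : Prop :=
  RotaBaxterLieBialgebra {
  rblb_liebi : lie_bialgebra br delta;
  rblb_rbla : rota_baxter_lie_algebra lam br P;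
  rblb_admissible : rb_admissible lam br P Q;
  rblb_coalgebra : forall x,
    tensor_map Q Q (delta x)
      = tensor_map Q idfun (delta (Q x)) + tensor_map idfun Q (delta (Q x))
        + lam *: delta (Q x);
  rblb_coadmissible : forall x,
    tensor_map P Q (delta x)
      + (tensor_map P idfun (delta (P x)) - tensor_map idfun Q (delta (P x)))
      + lam *: tensor_map P idfun (delta x) = 0
}.

Definition delta_r br r (x : g) : tensor g g := ad_tensor br x r.

Fact delta_r_is_linear br r : linear (delta_r br r).
Proof.
move=> a x y; rewrite /delta_r /ad_tensor scalerDr addrACA.
by congr (_ + _); apply: tensor_lift_linear_fun => u v;
  rewrite linearPl /= ?linearPl ?linearPr.
Qed.

HB.instance Definition _ br r :=
  GRing.isLinear.Build K g (tensor g g) _ (delta_r br r)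
    (delta_r_is_linear br r).

Definition coboundary_rota_baxter_lie_bialgebra lam br P delta Q : Prop :=
  rota_baxter_lie_bialgebra lam br P delta Q /\
  exists r, delta =1 delta_r br r.

Definition antisymmetric_tensor r : Prop := r = - tensor_flip r.

(* The three brackets of the classical Yang-Baxter equation, extended to two  *)
(* arguments by bilinearity, so that they do not depend on a decomposition of *)
(* r as a sum of pure tensors; see br12_13E, br12_23E and br13_23E.           *)
Definition br12_13 br r s : tensor g (tensor g g) :=
  tensor_lift (fun a b => tensor_lift (fun c d => br a c \ox (b \ox d)) s) r.

Definition br12_23 br r s : tensor g (tensor g g) :=
  tensor_lift (fun a b => tensor_lift (fun c d => a \ox (br b c \ox d)) s) r.

Definition br13_23 br r s : tensor g (tensor g g) :=
  tensor_lift (fun a b => tensor_lift (fun c d => a \ox (c \ox br b d)) s) r.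

Record admissible_cybe br P Q r : Prop := AdmissibleCYBE {
  cybe_eq : br12_13 br r r + br12_23 br r r + br13_23 br r r = 0;
  cybe_PQ : tensor_map P idfun r - tensor_map idfun Q r = 0;
  cybe_QP : tensor_map Q idfun r - tensor_map idfun P r = 0
}.

Lemma tensor_lift2_sum (W : vectType K) (f : g -> g -> g -> g -> W)
    (n : nat) (a b : 'I_n -> g) :
    (forall u v, bilinear_for *:%R *:%R (f u v)) ->
    (forall u v, bilinear_for *:%R *:%R (fun x y => f x y u v)) ->
  let r := \sum_(i < n) a i \ox b i in
  tensor_lift (fun u v => tensor_lift (f u v) r) r
    = \sum_(i < n) \sum_(j < n) f (a i) (b i) (a j) (b j).
Proof.
move=> f2 f1 r.
have inner u v : tensor_lift (f u v) r = \sum_(j < n) f u v (a j) (b j).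
  by rewrite linear_sum; apply: eq_bigr => j _; apply: tensor_liftE.
rewrite {2}/r linear_sum; apply: eq_bigr => i _.
rewrite /= -inner tensor_liftE //; split=> [v c u u' | u c v v'].
  rewrite !inner /= scaler_sumr -big_split; apply: eq_bigr => j _.
  exact: ((f1 (a j) (b j)).1 v c u u').
rewrite !inner /= scaler_sumr -big_split; apply: eq_bigr => j _.
exact: ((f1 (a j) (b j)).2 u c v v').
Qed.

Lemma br12_13E br (n : nat) (a b : 'I_n -> g) :
  let r := \sum_(i < n) a i \ox b i in
  br12_13 br r r
    = \sum_(i < n) \sum_(j < n) br (a i) (a j) \ox (b i \ox b j).
Proof.
apply: (tensor_lift2_sum (f := fun a b c d => br a c \ox (b \ox d))) => u v;
  split=> z k x y /=;
  by do 3 rewrite ?(linearPl, linearPr) /=.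
Qed.

Lemma br12_23E br (n : nat) (a b : 'I_n -> g) :
  let r := \sum_(i < n) a i \ox b i in
  br12_23 br r r
    = \sum_(i < n) \sum_(j < n) a i \ox (br (b i) (a j) \ox b j).
Proof.
apply: (tensor_lift2_sum (f := fun a b c d => a \ox (br b c \ox d))) => u v;
  split=> z k x y /=;
  by do 3 rewrite ?(linearPl, linearPr) /=.
Qed.

Lemma br13_23E br (n : nat) (a b : 'I_n -> g) :
  let r := \sum_(i < n) a i \ox b i in
  br13_23 br r r
    = \sum_(i < n) \sum_(j < n) a i \ox (a j \ox br (b i) (b j)).
Proof.
apply: (tensor_lift2_sum (f := fun a b c d => a \ox (c \ox br b d))) => u v;
  split=> z k x y /=;
  by do 3 rewrite ?(linearPl, linearPr) /=.
Qed.

End LieBialgebra.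

(* Main.v *)
(* Write [r = \sum_i a_i (x) b_i].  Antisymmetry makes the three terms of the
   classical Yang-Baxter equation cyclic permutations of one another.  In the
   co-Jacobi sum, half of the terms are [ad(x)] acting on the first leg of
   [r12,r23] + [r13,r23] = - [r12,r13], summed cyclically; by the Jacobi identity
   the other half is [ad(x)] acting on the second leg of [r12,r23], summed
   cyclically, and the two cancel.  In the Rota-Baxter compatibilities the
   equations [Pa (x) b = a (x) Qb] and [Qa (x) b = a (x) Pb] move [P] and [Q]
   inside one bracket, where the identity left is the Rota-Baxter equation or
   [Q]-admissibility. *)
Require Import Defs.
From HB Require Import structures.
From mathcomp Require Import all_boot all_order all_algebra ring.

Set Implicit Arguments.
Unset Strict Implicit.
Unset Printing Implicit Defensive.

Import GRing.Theory.
Local Open Scope ring_scope.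

(** * Tensors as finite sums of pure tensors, and rewriting under bilinear maps *)

Section TensorSums.
Variable K : fieldType.

Lemma tensor_sum_pure (U V : vectType K) (t : tensor U V) :
  exists (n : nat) (a : 'I_n -> U) (b : 'I_n -> V), t = \sum_i a i \ox b i.
Proof.
(* Coordinates are grouped by rows: the i-th basis vector of [U] is paired with the vector of [V]
   whose coordinates form the i-th row. *)
exists (\dim {:U}), (fun i => (vbasis {:U})`_i),
  (fun i => \sum_(j < \dim {:V}) (t : 'M_(_, _)) i j *: (vbasis {:V})`_j).
rewrite {1}(tensor_std t); apply: eq_bigr => i _.
by rewrite linear_sumr; apply: eq_bigr => j _; rewrite linearZr_LR.
Qed.

(** Scalars are absorbed into pure tensors, and the empty sum is the pure tensor [0 \ox 0], so pure
    tensors and addition suffice. *)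
Lemma tensor_ind (U V : vectType K) (p : tensor U V -> Prop) :
    (forall u v, p (u \ox v)) -> (forall s t, p s -> p t -> p (s + t)) ->
  forall t, p t.
Proof.
move=> p_tens pD t; have [n [a [b ->]]] := tensor_sum_pure t.
have tens0 : 0 \ox 0 = 0 :> tensor U V by rewrite linear0r.
by apply: big_ind => //; rewrite -tens0.
Qed.

Lemma tensor_lift_sum (U V W : vectType K) (m : U -> V -> W) n
    (a : 'I_n -> U) (b : 'I_n -> V) :
    bilinear_for *:%R *:%R m ->
  tensor_lift m (\sum_i a i \ox b i) = \sum_i m (a i) (b i).
Proof.
by move=> m2; rewrite linear_sum; apply: eq_bigr => i _; apply: tensor_liftE.
Qed.

Lemma tensor_map_sum (U V U' V' : vectType K) n (a : 'I_n -> U) (b : 'I_n -> V)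
    (f : {linear U -> U'}) (h : {linear V -> V'}) :
  tensor_map f h (\sum_i a i \ox b i) = \sum_i f (a i) \ox h (b i).
Proof. by rewrite linear_sum; apply: eq_bigr => i _; apply: tensor_mapE. Qed.

(** The linear map induced by [m] is applied to both sides; an equation between tensors can thus be
    used inside any bilinear expression, although it does not hold summand by summand. *)
Lemma eq_sum_of_tensor_map (U V U' V' W : vectType K) n
    (a : 'I_n -> U) (b : 'I_n -> V) (f f' : {linear U -> U'})
    (h h' : {linear V -> V'}) (m : U' -> V' -> W) :
    bilinear_for *:%R *:%R m ->
    tensor_map f h (\sum_i a i \ox b i) = tensor_map f' h' (\sum_i a i \ox b i) ->
  \sum_i m (f (a i)) (h (b i)) = \sum_i m (f' (a i)) (h' (b i)).
Proof.
move=> m2; rewrite !tensor_map_sum => /(congr1 (tensor_lift m)).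
by rewrite !tensor_lift_sum.
Qed.

Lemma antisymmetric_sum (U W : vectType K) n (a b : 'I_n -> U) (m : U -> U -> W) :
    bilinear_for *:%R *:%R m -> antisymmetric_tensor (\sum_i a i \ox b i) ->
  \sum_i m (a i) (b i) = - \sum_i m (b i) (a i).
Proof.
move=> m2; rewrite /antisymmetric_tensor.
have -> : tensor_flip (\sum_i a i \ox b i) = \sum_i b i \ox a i.
  by rewrite linear_sum; apply: eq_bigr => i _; apply: tensor_flipE.
by move/(congr1 (tensor_lift m)); rewrite linearN /= !tensor_lift_sum.
Qed.

(** Both sides are additive, so two nested inductions reduce to pure tensors. This later carries
    [ad(x)] from one leg to the next. *)
Lemma tensor_cycle_map (U V W U' V' W' : vectType K) (f : {linear U -> U'})
    (h : {linear V -> V'}) (k : {linear W -> W'}) (t : tensor U (tensor V W)) :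
  tensor_cycle (tensor_map f (tensor_map h k) t)
    = tensor_map k (tensor_map f h) (tensor_cycle t).
Proof.
elim/tensor_ind: t => [u vw|t t' IHt IHt']; last first.
  by rewrite !linearD /= IHt IHt'.
elim/tensor_ind: vw => [v w|t t' IHt IHt']; last first.
  by rewrite linearDr !linearD /= IHt IHt'.
by do 2 rewrite ?tensor_cycleE !tensor_mapE /=; rewrite tensor_cycleE.
Qed.

End TensorSums.

(** * Cocycle condition and co-antisymmetry of [delta_r] *)

Section Coboundary.
Variables (K : fieldType) (g : vectType K) (br : {bilinear g -> g -> g}).
Hypothesis lie_br : lie_algebra br.

Lemma lie_antisym x y : br x y = - br y x.
Proof.
apply/eqP; rewrite -addr_eq0; apply/eqP; move: (lie_alternating lie_br (x + y)).
by rewrite linearDl !linearDr /= !(lie_alternating lie_br) add0r addr0 addrC.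
Qed.

Lemma lie_derivation x y z : br x (br y z) = br (br x y) z + br y (br x z).
Proof.
rewrite (lie_antisym (br x y)) (lie_antisym x z) linearNr /= -opprD.
by apply/eqP; rewrite -addr_eq0 addrA addrAC (lie_jacobi lie_br).
Qed.

Lemma tensor_map_delta_r (f h : {linear g -> g}) n (a b : 'I_n -> g) x :
  tensor_map f h (delta_r br (\sum_i a i \ox b i) x)
    = \sum_i f (br x (a i)) \ox h (b i) + \sum_i f (a i) \ox h (br x (b i)).
Proof.
rewrite /delta_r /ad_tensor linearD /=.
rewrite (tensor_map_sum a b (br x) idfun) (tensor_map_sum a b idfun (br x)).
by rewrite !tensor_map_sum.
Qed.

Lemma delta_r_sum n (a b : 'I_n -> g) x :
  delta_r br (\sum_i a i \ox b i) x
    = \sum_i br x (a i) \ox b i + \sum_i a i \ox br x (b i).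
Proof.
by rewrite /delta_r /ad_tensor (tensor_map_sum a b (br x) idfun)
  (tensor_map_sum a b idfun (br x)).
Qed.

(** The terms with [br x] on one leg and [br y] on the other occur in both iterated actions and
    cancel; on each single leg what remains is the Jacobi identity. *)
Lemma delta_r_cocycle r x y :
  delta_r br r (br x y)
    = ad_tensor br x (delta_r br r y) - ad_tensor br y (delta_r br r x).
Proof.
have [n [a [b ->]]] := tensor_sum_pure r.
rewrite /ad_tensor (tensor_map_delta_r (br x) idfun)
  (tensor_map_delta_r idfun (br x)) (tensor_map_delta_r (br y) idfun)
  (tensor_map_delta_r idfun (br y)) delta_r_sum -!big_split -sumrB /=.
apply: eq_bigr => i _.
have jac z : br (br x y) z = br x (br y z) - br y (br x z).
  by rewrite (lie_derivation x y) addrK.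
rewrite !jac linearBl linearBr /=.
(* A linear identity between tensors, read entrywise so that [ring] applies. *)
by apply/matrixP=> k l; rewrite !mxE; ring.
Qed.

(** The flip exchanges the two summands of [delta_r] up to swapping [a] and [b], and antisymmetry of
    [r] swaps them back with a sign. *)
Lemma delta_r_antisym r x :
  antisymmetric_tensor r -> delta_r br r x = - tensor_flip (delta_r br r x).
Proof.
have [n [a [b ->]]] := tensor_sum_pure r => antisym_r.
rewrite delta_r_sum linearD /= !linear_sum /=.
under [in RHS]eq_bigr do rewrite tensor_flipE.
under [X in _ = - (_ + X)]eq_bigr do rewrite tensor_flipE.
rewrite opprD addrC; congr (_ + _).
  rewrite (antisymmetric_sum (m := fun u v => u \ox br x v)) //.
  by split=> z k u v; rewrite ?linearPr /= ?(linearPl, linearPr).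
rewrite (antisymmetric_sum (m := fun u v => br x u \ox v)) //.
by split=> z k u v; rewrite ?linearPr /= ?(linearPl, linearPr).
Qed.

End Coboundary.

(** * Co-Jacobi identity from the classical Yang-Baxter equation *)

Section CoJacobi.
Variables (K : fieldType) (g : vectType K) (br : {bilinear g -> g -> g}).
Hypothesis lie_br : lie_algebra br.
Variables (n : nat) (a b : 'I_n -> g).
Let r : tensor g g := \sum_i a i \ox b i.
Hypothesis antisym_r : antisymmetric_tensor r.

Lemma tensor_cycle_sum2 (f h k : 'I_n -> 'I_n -> g) :
  tensor_cycle (\sum_i \sum_j f i j \ox (h i j \ox k i j))
    = \sum_i \sum_j k i j \ox (f i j \ox h i j).
Proof.
rewrite linear_sum; apply: eq_bigr => i _ /=.
by rewrite linear_sum; apply: eq_bigr => j _; apply: tensor_cycleE.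
Qed.

Lemma tensor_map_sum2 (p q s : {linear g -> g}) (f h k : 'I_n -> 'I_n -> g) :
  tensor_map p (tensor_map q s) (\sum_i \sum_j f i j \ox (h i j \ox k i j))
    = \sum_i \sum_j p (f i j) \ox (q (h i j) \ox s (k i j)).
Proof.
rewrite linear_sum; apply: eq_bigr => i _ /=.
rewrite linear_sum; apply: eq_bigr => j _ /=.
by do 2 rewrite tensor_mapE /=.
Qed.

(** Antisymmetry is applied to one copy of [r] while the other is frozen: the outer copy here, the
    inner one in [antisymmetric_sum2r]. *)
Lemma antisymmetric_sum2l (W : vectType K) (f : g -> g -> g -> g -> W) :
    (forall u v, bilinear_for *:%R *:%R (fun x y => f x y u v)) ->
  \sum_i \sum_j f (a i) (b i) (a j) (b j)
    = - \sum_i \sum_j f (b i) (a i) (a j) (b j).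
Proof.
move=> f2; rewrite exchange_big [in RHS]exchange_big -sumrN.
by apply: eq_bigr => j _; apply: (antisymmetric_sum (f2 (a j) (b j))).
Qed.

Lemma antisymmetric_sum2r (W : vectType K) (f : g -> g -> g -> g -> W) :
    (forall u v, bilinear_for *:%R *:%R (f u v)) ->
  \sum_i \sum_j f (a i) (b i) (a j) (b j)
    = - \sum_i \sum_j f (a i) (b i) (b j) (a j).
Proof.
move=> f2; rewrite -sumrN.
by apply: eq_bigr => i _; apply: (antisymmetric_sum (f2 (a i) (b i))).
Qed.

(** After exchanging [i] and [j], one sign comes from flipping a copy of [r] and one from the
    bracket. The same holds for [tensor_cycle_br12_23]. *)
Lemma tensor_cycle_br12_13 : tensor_cycle (br12_13 br r r) = br12_23 br r r.
Proof.
rewrite br12_13E br12_23E tensor_cycle_sum2 exchange_big /=.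
rewrite (antisymmetric_sum2l (f := fun u v u' v' => u \ox (br v u' \ox v'))).
  rewrite -sumrN; apply: eq_bigr => i _; rewrite -sumrN; apply: eq_bigr => j _.
  by rewrite (lie_antisym lie_br) linearNl linearNr.
by move=> u v; split=> z k x y; do 3 rewrite ?(linearPl, linearPr) /=.
Qed.

Lemma tensor_cycle_br12_23 : tensor_cycle (br12_23 br r r) = br13_23 br r r.
Proof.
rewrite br12_23E br13_23E tensor_cycle_sum2 exchange_big /=.
rewrite (antisymmetric_sum2l (f := fun u v u' v' => u \ox (u' \ox br v v'))).
  rewrite -sumrN; apply: eq_bigr => i _; rewrite -sumrN; apply: eq_bigr => j _.
  by rewrite (lie_antisym lie_br) !linearNr.
by move=> u v; split=> z k x y; do 3 rewrite ?(linearPl, linearPr) /=.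
Qed.

(** Here the two signs come from flipping both copies of [r]. *)
Lemma tensor_cycle_br13_23 : tensor_cycle (br13_23 br r r) = br12_13 br r r.
Proof.
rewrite br12_13E br13_23E tensor_cycle_sum2 /=.
rewrite (antisymmetric_sum2l (f := fun u v u' v' => br u u' \ox (v \ox v'))).
  rewrite (antisymmetric_sum2r (f := fun u v u' v' => br v u' \ox (u \ox v'))).
    by rewrite opprK.
  by move=> u v; split=> z k x y; do 3 rewrite ?(linearPl, linearPr) /=.
by move=> u v; split=> z k x y; do 3 rewrite ?(linearPl, linearPr) /=.
Qed.

(** The identities are spelled out leg by leg, so that [tensor_cycle_map] permutes [on1], [on2] and
    [on3] cyclically. *)
Let on1 x := tensor_map (br x) (tensor_map (@idfun g) (@idfun g)).
Let on2 x := tensor_map (@idfun g) (tensor_map (br x) (@idfun g)).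
Let on3 x := tensor_map (@idfun g) (tensor_map (@idfun g) (br x)).

(** [t12] and [t13] are the terms of [br12_23] and [br13_23] with [b i] replaced by [br x (b i)]
    inside the bracket. *)
Let t12 x : tensor g (tensor g g) :=
  \sum_i \sum_j a i \ox (br (br x (b i)) (a j) \ox b j).
Let t13 x : tensor g (tensor g g) :=
  \sum_i \sum_j a i \ox (a j \ox br (br x (b i)) (b j)).

(** The summand of [delta_r br r x] with [br x] on [a i] gives the [on1] term; the one with [br x]
    on [b i] gives [t12] and [t13]. *)
Lemma delta_r_delta_r x :
  tensor_map idfun (delta_r br r) (delta_r br r x)
    = on1 x (br12_23 br r r + br13_23 br r r) + t12 x + t13 x.
Proof.
rewrite delta_r_sum linearD /=.
have mapE (c d : 'I_n -> g) :
    tensor_map idfun (delta_r br r) (\sum_i c i \ox d i)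
    = \sum_i \sum_j c i \ox (br (d i) (a j) \ox b j)
      + \sum_i \sum_j c i \ox (a j \ox br (d i) (b j)).
  rewrite (tensor_map_sum c d idfun (delta_r br r)) /= -big_split.
  apply: eq_bigr => i _; rewrite /= -!linear_sumr /=.
  by rewrite delta_r_sum -linearDr.
rewrite !mapE -[RHS]addrA; congr (_ + _).
by rewrite br12_23E br13_23E /on1 linearD /= !(tensor_map_sum2 (br x) idfun idfun).
Qed.

(** Since [br x] is a derivation, it hits either [b i], giving [t12], or [a j]; flipping the second
    copy of [r] and the bracket turns the latter into [t13] cycled twice. *)
Lemma on2_br12_23 x :
  on2 x (br12_23 br r r) = t12 x + tensor_cycle (tensor_cycle (t13 x)).
Proof.
rewrite br12_23E /on2 (tensor_map_sum2 idfun (br x) idfun) !tensor_cycle_sum2.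
have -> : \sum_i \sum_j a j \ox (br (br x (b i)) (b j) \ox a i)
    = \sum_i \sum_j a i \ox (br (b i) (br x (a j)) \ox b j).
  rewrite exchange_big (antisymmetric_sum2r
    (f := fun u v u' v' => u \ox (br v (br x u') \ox v'))) /=.
    rewrite -sumrN; apply: eq_bigr => i _; rewrite -sumrN; apply: eq_bigr => j _.
    by rewrite (lie_antisym lie_br) linearNl linearNr.
  by move=> u v; split=> z k y y'; do 4 rewrite ?(linearPl, linearPr) /=.
rewrite /t12 -big_split; apply: eq_bigr => i _ /=.
rewrite -big_split; apply: eq_bigr => j _ /=.
by rewrite (lie_derivation lie_br x) linearDl linearDr.
Qed.

Lemma cojacobi_delta_r x :
    br12_13 br r r + br12_23 br r r + br13_23 br r r = 0 ->
  let t := tensor_map idfun (delta_r br r) (delta_r br r x) in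
  t + tensor_cycle t + tensor_cycle (tensor_cycle t) = 0.
Proof.
move=> cybe_r; rewrite delta_r_delta_r /=.
have {cybe_r} -> : br12_23 br r r + br13_23 br r r = - br12_13 br r r.
  by apply/eqP; rewrite -addr_eq0 addrC addrA cybe_r.
have c1 t : tensor_cycle (on1 x t) = on2 x (tensor_cycle t).
  exact: tensor_cycle_map.
have c2 t : tensor_cycle (on2 x t) = on3 x (tensor_cycle t).
  exact: tensor_cycle_map.
have c3 t : tensor_cycle (on3 x t) = on1 x (tensor_cycle t).
  exact: tensor_cycle_map.
have on1N t : on1 x (- t) = - on1 x t by rewrite /on1 linearN.
have cycleD (s t : tensor g (tensor g g)) :
  tensor_cycle (s + t) = tensor_cycle s + tensor_cycle t by rewrite linearD.
have cycleN (t : tensor g (tensor g g)) :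
  tensor_cycle (- t) = - tensor_cycle t by rewrite linearN.
have cycle3 : tensor_cycle (tensor_cycle (tensor_cycle (t13 x))) = t13 x.
  by rewrite /t13 !tensor_cycle_sum2.
(* Cycling [e2] gives its analogues [e3] and [e1] on the other legs; their right-hand sides add up
   to the full cyclic sums of [t12] and [t13]. *)
have e2 := on2_br12_23 x.
have e3 : on3 x (br13_23 br r r) = tensor_cycle (t12 x) + t13 x.
  by rewrite -tensor_cycle_br12_23 -c2 e2 cycleD cycle3.
have e1 : on1 x (br12_13 br r r)
    = tensor_cycle (tensor_cycle (t12 x)) + tensor_cycle (t13 x).
  by rewrite -tensor_cycle_br13_23 -c3 e3 cycleD.
rewrite on1N !cycleD !cycleN c1 tensor_cycle_br12_13 c2 tensor_cycle_br12_23.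
rewrite e1 e2 e3; move: (t12 x) (t13 x) => t t'.
by apply/matrixP=> k l; rewrite !mxE; ring.
Qed.

End CoJacobi.

(** * Compatibility of [delta_r] with [P] and [Q] *)

Section RotaBaxter.
Variables (K : fieldType) (lam : K) (g : vectType K).
Variables (br : {bilinear g -> g -> g}) (P Q : {linear g -> g}).
Hypothesis rbP : rota_baxter_lie_algebra lam br P.
Hypothesis admQ : rb_admissible lam br P Q.
Variable r : tensor g g.
Hypothesis cybe_r : admissible_cybe br P Q r.

Let lie_br : lie_algebra br := rbla_lie rbP.

(** The equation [cybe_PQ] seen through [m]: [P] on the left leg is traded for [Q] on the right
    leg. *)
Let move_PQ (W : vectType K) n (a b : 'I_n -> g) (m : g -> g -> W) :
    bilinear_for *:%R *:%R m -> r = \sum_i a i \ox b i ->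
  \sum_i m (P (a i)) (b i) = \sum_i m (a i) (Q (b i)).
Proof.
move=> m2 rE; apply: (eq_sum_of_tensor_map (f := P) (h := idfun)
  (f' := idfun) (h' := Q) m2); rewrite -rE.
by apply/eqP; rewrite -subr_eq0 (cybe_PQ cybe_r).
Qed.

Let move_QP (W : vectType K) n (a b : 'I_n -> g) (m : g -> g -> W) :
    bilinear_for *:%R *:%R m -> r = \sum_i a i \ox b i ->
  \sum_i m (Q (a i)) (b i) = \sum_i m (a i) (P (b i)).
Proof.
move=> m2 rE; apply: (eq_sum_of_tensor_map (f := Q) (h := idfun)
  (f' := idfun) (h' := P) m2); rewrite -rE.
by apply/eqP; rewrite -subr_eq0 (cybe_QP cybe_r).
Qed.

(** Admissibility at [y], [x] with every bracket reversed, solved for the term where [P] sits in the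
    second argument. *)
Let rb_admissible_swap x y :
  Q (br x (P y)) = br (Q x) (P y) + Q (br (Q x) y) + lam *: br (Q x) y.
Proof.
have /eqP := admQ y x; rewrite -!addrA -!opprD subr_eq0 => /eqP.
rewrite (lie_antisym lie_br (P y)) (lie_antisym lie_br (P y)).
rewrite (lie_antisym lie_br y) !linearN /= -!opprD => /oppr_inj ->.
by rewrite addrA.
Qed.

Lemma delta_r_coalgebra x :
  tensor_map Q Q (delta_r br r x)
    = tensor_map Q idfun (delta_r br r (Q x))
      + tensor_map idfun Q (delta_r br r (Q x)) + lam *: delta_r br r (Q x).
Proof.
have [n [a [b rE]]] := tensor_sum_pure r; rewrite rE.
rewrite (tensor_map_delta_r br Q Q) (tensor_map_delta_r br Q idfun).
rewrite (tensor_map_delta_r br idfun Q) delta_r_sum /=.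
(* After these moves every summand has a bare [b i] on the right or a bare [a i] on the left;
   [rb_admissible_swap] then settles each leg termwise. *)
rewrite -(move_PQ (m := fun u v => Q (br x u) \ox v)) //.
  rewrite (move_QP (m := fun u v => u \ox Q (br x v))) //.
  rewrite (move_QP (m := fun u v => u \ox br (Q x) v)) //.
  rewrite -(move_PQ (m := fun u v => br (Q x) u \ox v)) //.
  rewrite scalerDr !scaler_sumr -!big_split; apply: eq_bigr => i _ /=.
  rewrite !rb_admissible_swap !(linearDl, linearDr) /= linearZl_LR linearZr_LR.
  by apply/matrixP=> k l; rewrite !mxE; ring.
all: by split=> z k u v; do 3 rewrite ?(linearPl, linearPr, linearP) /=.
Qed.

Lemma delta_r_coadmissible x :
  tensor_map P Q (delta_r br r x)
    + (tensor_map P idfun (delta_r br r (P x))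
       - tensor_map idfun Q (delta_r br r (P x)))
    + lam *: tensor_map P idfun (delta_r br r x) = 0.
Proof.
have [n [a [b rE]]] := tensor_sum_pure r; rewrite rE.
rewrite (tensor_map_delta_r br P Q).
rewrite !(tensor_map_delta_r br P idfun) (tensor_map_delta_r br idfun Q) /=.
(* The moves again leave one leg bare: terms ending in [b i] cancel by the Rota-Baxter equation,
   terms starting with [a i] by admissibility. *)
rewrite -(move_PQ (m := fun u v => P (br x u) \ox v)) //.
  rewrite (move_PQ (m := fun u v => u \ox Q (br x v))) //.
  rewrite (move_PQ (m := fun u v => u \ox br (P x) v)) //.
  rewrite (move_PQ (m := fun u v => u \ox br x v)) //.
  rewrite -(move_PQ (m := fun u v => br (P x) u \ox v)) //.
  rewrite scalerDr !scaler_sumr opprD -!sumrN -!big_split big1 // => i _ /=.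
  have -> : Q (br (P x) (b i)) = br (P x) (Q (b i)) + Q (br x (Q (b i)))
      + lam *: br x (Q (b i)).
    have /eqP := admQ x (b i); rewrite -!addrA -!opprD subr_eq0 => /eqP ->.
    by rewrite addrA.
  rewrite (rbla_rota_baxter rbP) !(linearDl, linearDr) /= linearZl_LR linearZr_LR.
  by apply/matrixP=> k l; rewrite !mxE; ring.
all: by split=> z k u v; do 3 rewrite ?(linearPl, linearPr, linearP) /=.
Qed.

End RotaBaxter.

Theorem proposition4p6 (K : fieldType) (charK0 : [pchar K] =i pred0)
    (lam : K) (g : vectType K) (br : {bilinear g -> g -> g})
    (P Q : {linear g -> g}) (r : tensor g g)
    (rbP : rota_baxter_lie_algebra lam br P)
    (admQ : rb_admissible lam br P Q)
    (antisym_r : antisymmetric_tensor r)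
    (cybe_r : admissible_cybe br P Q r) :
  coboundary_rota_baxter_lie_bialgebra lam br P (delta_r br r) Q.
Proof.
have lie_br := rbla_lie rbP.
split; last by exists r.
split=> // [|x|x]; last 2 first.
- exact: (delta_r_coalgebra rbP).
- exact: (delta_r_coadmissible rbP).
split=> // [|x y]; last exact: delta_r_cocycle.
split=> x; first exact: delta_r_antisym.
have [n [a [b rE]]] := tensor_sum_pure r.
have := cybe_eq cybe_r; rewrite rE in antisym_r *.
exact: cojacobi_delta_r.
Qed.
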